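(* For positive integers $K\le P$ and $\theta=(K,P)$, we have $\lim_{n\to\infty}C^\star(\mathbb{K}(n;\theta))=C_{\rm K}(\theta)$ almost surely, where $C_{\rm K}(\theta)=\beta(\theta)/(1-q(\theta))^2$.
   Context: Random key graph: for positive integers $K\le P$, $\theta=(K,P)$ and $n\ge3$, let $K_1(\theta),\dots,K_n(\theta)$ be i.i.d. random subsets of $\{1,\dots,P\}$, each uniform over the $K$-element subsets; the random key graph $\mathbb{K}(n;\theta)$ on $\{1,\dots,n\}$ has an edge between distinct $i,j$ iff $K_i(\theta)\cap K_j(\theta)\ne\emptyset$. All graphs for different $n$ are defined on a common probability space. $q(\theta)=\binom{P-K}{K}/\binom{P}{K}$ if $2K\le P$ and $0$ otherwise; $r(\theta)=\binom{P-2K}{K}/\binom{P}{K}$ if $3K\le P$ and $0$ otherwise; $\beta(\theta)=(1-q)^3+q^3-qr$. For a finite simple graph $G$ with vertex set $V$, let $T_i(G)$ be the number of triangles containing vertex $i$ and $d_i$ its degree; the global clustering coefficient is $C^\star(G)=\sum_{i\in V}T_i(G)\big/\big(\tfrac12\sum_{i\in V}d_i(d_i-1)\big)$ if $\sum_i d_i(d_i-1)>0$, and $C^\star(G)=0$ otherwise. *)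

(* Defs.v *)
From mathcomp Require Import all_boot.
From Stdlib Require Import Reals.

Set Implicit Arguments.
Unset Strict Implicit.
Unset Printing Implicit Defensive.

Definition KS (K P : nat) : finType := {A : {set 'I_P} | #|A| == K}.

(* A sample point: the infinite i.i.d. sequence of key rings K_1, K_2, ...
   (vertex i of the graph on n vertices, i : 'I_n, uses key ring w i). *)
Definition sample (K P : nat) := nat -> KS K P.

Definition in_cyl (K P m : nat) (A : {set {ffun 'I_m -> KS K P}}) (w : sample K P) : Prop :=
  [ffun i : 'I_m => w (nat_of_ord i)] \in A.

(* Its probability under the uniform i.i.d. product measure. *)
Definition cyl_prob (K P m : nat) (A : {set {ffun 'I_m -> KS K P}}) : R :=
  (INR #|A| / INR (#|KS K P| ^ m))%R.

Definition null_set (K P : nat) (N : sample K P -> Prop) : Prop :=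
  forall eps : R, (0 < eps)%R ->
    exists (m : nat -> nat) (A : forall j : nat, {set {ffun 'I_(m j) -> KS K P}}),
      (forall w, N w -> exists j, in_cyl (A j) w) /\
      (forall J : nat, (sum_f_R0 (fun j => cyl_prob (A j)) J <= eps)%R).

Definition almost_surely (K P : nat) (E : sample K P -> Prop) : Prop :=
  null_set (fun w => ~ E w).

Definition rkg_adj (K P : nat) (w : sample K P) (n : nat) (i j : 'I_n) : bool :=
  (i != j) && (val (w (nat_of_ord i)) :&: val (w (nat_of_ord j)) != set0).

Definition rkg_deg (K P : nat) (w : sample K P) (n : nat) (i : 'I_n) : nat :=
  #|[set j : 'I_n | rkg_adj w i j]|.

Definition rkg_tri (K P : nat) (w : sample K P) (n : nat) (i : 'I_n) : nat :=
  #|[set p : 'I_n * 'I_n |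
      [&& rkg_adj w i p.1, rkg_adj w i p.2, rkg_adj w p.1 p.2 & (p.1 < p.2)%N]]|.

Definition Cstar (K P : nat) (w : sample K P) (n : nat) : R :=
  let sT := (\sum_(i < n) rkg_tri w i)%N in
  let sD := (\sum_(i < n) rkg_deg w i * (rkg_deg w i - 1))%N in
  if (0 < sD)%N then (INR sT / (INR sD / 2))%R else 0%R.

Definition q_theta (K P : nat) : R :=
  if (2 * K <= P)%N then (INR 'C(P - K, K) / INR 'C(P, K))%R else 0%R.

Definition r_theta (K P : nat) : R :=
  if (3 * K <= P)%N then (INR 'C(P - 2 * K, K) / INR 'C(P, K))%R else 0%R.

Definition beta_theta (K P : nat) : R :=
  let q := q_theta K P in
  ((1 - q) ^ 3 + q ^ 3 - q * r_theta K P)%R.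

Definition C_K (K P : nat) : R := (beta_theta K P / (1 - q_theta K P) ^ 2)%R.

(* Main.v *)
From Stdlib Require Import Reals.
From mathcomp Require Import all_boot all_order all_algebra Rstruct zify ring lra.
From mathcomp Require boolp.
Require Import Defs.

(* By Hoeffding's inequality with deviation n^(-1/4) and Borel-Cantelli, almost
   surely every key ring a has asymptotic frequency 1/M among w 0, ..., w (n-1),
   where M = 'C(P, K).  On that event the limit is deterministic: up to O(n^2)
   the numbers of triangles and of paths of length 2 are triple sums over the
   vertices of a function of the key rings, so after division by n^3 they
   converge to averages over triples of key rings, namely beta and (1 - q)^2. *)

Set Implicit Arguments.
Unset Strict Implicit.
Unset Printing Implicit Defensive.

Import Order.TTheory GRing.Theory Num.Theory.

Local Open Scope ring_scope.
(* These arguments would otherwise be parsed in R_scope. *)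
Local Arguments Un_cv (Un l)%_ring_scope.
Local Arguments exp x%_ring_scope.

(** * Limits of real sequences *)

Lemma Un_cvP (u : nat -> R) (a : R) :
  Un_cv u a <-> forall e : R, 0 < e ->
    exists N : nat, forall n : nat, (N <= n)%N -> `|u n - a| < e.
Proof.
split=> ua e e0.
  have [N HN] := ua e (elimT RltP e0); exists N => n /ssrnat.leP Nn.
  by rewrite -RdistE; apply/RltP/HN.
have [N HN] := ua e (introT RltP e0); exists N => n /ssrnat.leP Nn.
by apply/RltP; rewrite RdistE HN.
Qed.

Lemma Un_cvD (u v : nat -> R) (a b : R) :
  Un_cv u a -> Un_cv v b -> Un_cv (fun n => u n + v n) (a + b).
Proof. exact: CV_plus. Qed.

Lemma Un_cvB (u v : nat -> R) (a b : R) :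
  Un_cv u a -> Un_cv v b -> Un_cv (fun n => u n - v n) (a - b).
Proof. exact: CV_minus. Qed.

Lemma Un_cvM (u v : nat -> R) (a b : R) :
  Un_cv u a -> Un_cv v b -> Un_cv (fun n => u n * v n) (a * b).
Proof. exact: CV_mult. Qed.

Lemma Un_cv_cst (a : R) : Un_cv (fun=> a) a.
Proof.
by apply/Un_cvP => e e0; exists 0%N => n _; rewrite subrr normr0.
Qed.

Lemma Un_cvV (u : nat -> R) (a : R) :
  a != 0 -> Un_cv u a -> Un_cv (fun n => (u n)^-1) a^-1.
Proof.
move=> a0 ua; apply: (continuity_seq Rinv) => //.
apply: (continuity_pt_inv id); first exact/derivable_continuous_pt/derivable_pt_id.
exact/eqP.
Qed.

Lemma Un_cv_sum (I : finType) (u : nat -> I -> R) (a : I -> R) :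
  (forall i, Un_cv (u^~ i) (a i)) ->
  Un_cv (fun n => \sum_i u n i) (\sum_i a i).
Proof.
move=> ua; elim: (index_enum I) => [|i s IHs].
  by rewrite big_nil; apply: Un_cv_ext (Un_cv_cst 0) => n; rewrite big_nil.
rewrite big_cons; apply: Un_cv_ext (Un_cvD (ua i) IHs) => n.
by rewrite big_cons.
Qed.

Lemma Un_cv_invn : Un_cv (fun n => n%:R^-1) 0.
Proof.
apply: Un_cv_ext (cv_infty_cv_0 _ _); first by move=> n; rewrite -INRE.
move=> M; have [N HN] := INR_unbounded M; exists N => n Nn.
by apply: Rlt_le_trans HN _; apply: le_INR.
Qed.

Lemma Un_cv_divn (c : R) : Un_cv (fun n => c / n%:R) 0.
Proof. by rewrite -[0](mulr0 c); apply: Un_cvM (Un_cv_cst c) Un_cv_invn. Qed.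

Lemma Un_cv_close (u v b : nat -> R) (a : R) :
  (forall n, `|v n - u n| <= b n) -> Un_cv b 0 -> Un_cv u a -> Un_cv v a.
Proof.
move=> uvb /Un_cvP b0 /Un_cvP ua; apply/Un_cvP => e e0.
have e2 : 0 < e / 2 by lra.
have [[N1 H1] [N2 H2]] := (b0 _ e2, ua _ e2); exists (N1 + N2)%N => n Nn.
have {}H1 := H1 n (leq_trans (leq_addr _ _) Nn).
have {}H2 := H2 n (leq_trans (leq_addl _ _) Nn).
have := ler_normD (v n - u n) (u n - a); rewrite addrA subrK.
by have := ler_norm (b n); move: H1 (uvb n); rewrite subr0; lra.
Qed.

(** * Empirical means under convergent frequencies *)

Section Means.
Variables (F : finType) (w : nat -> F) (M : R).
Hypothesis freq : forall a,
  Un_cv (fun n => (\sum_(i < n) (w i == a)%:R) / n%:R) M^-1.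

(** Grouping the indices by the value of [w i] turns the mean into a finite sum over [a] of [g n a]
    times the frequency of [a], and limits pass through finite sums. Letting [g] depend on [n]
    allows nested means to be treated one sum at a time. *)
Lemma mean_cv (g : nat -> F -> R) (G : F -> R) :
  (forall a, Un_cv (g^~ a) (G a)) ->
  Un_cv (fun n => (\sum_(i < n) g n (w i)) / n%:R) ((\sum_a G a) / M).
Proof.
move=> gG; rewrite mulr_suml.
apply: Un_cv_ext (Un_cv_sum (fun a => Un_cvM (gG a) (freq a))) => n /=.
rewrite mulr_suml; under [LHS]eq_bigr do rewrite mulr_suml mulr_sumr.
rewrite exchange_big /=; apply: eq_bigr => i _.
rewrite (bigD1 (w i)) //= eqxx mul1r big1 ?addr0 // => a /negPf aw.
by rewrite eq_sym aw mul0r mulr0.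
Qed.

End Means.

(** * Subgraph counts *)

Lemma natr_card (T : finType) (P : pred T) :
  #|[set x | P x]|%:R = \sum_x (P x)%:R :> R.
Proof.
rewrite cardsE -sum1_card natr_sum big_mkcond /=.
by apply: eq_bigr => x _; rewrite unfold_in; case: (P x).
Qed.

Section Graph.
Variables (K P : nat) (w : sample K P).
Hypothesis K_gt0 : (0 < K)%N.

(** Adjacency without the condition [i != j]: it depends on the key rings alone, so sums of it are
    governed by frequencies. *)
Definition share (a b : KS K P) : bool := val a :&: val b != set0.

Lemma shareC a b : share a b = share b a.
Proof. by rewrite /share setIC. Qed.

Lemma sharexx a : share a a.
Proof. by rewrite /share setIid -card_gt0 (eqP (valP a)). Qed.

Lemma rkg_adjE n (i j : 'I_n) : rkg_adj w i j = (i != j) && share (w i) (w j).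
Proof. by []. Qed.

Lemma rkg_adjC n (i j : 'I_n) : rkg_adj w i j = rkg_adj w j i.
Proof. by rewrite !rkg_adjE eq_sym shareC. Qed.

Lemma rkg_adjxx n (i : 'I_n) : rkg_adj w i i = false.
Proof. by rewrite rkg_adjE eqxx. Qed.

Lemma rkg_degE n (i : 'I_n) :
  (rkg_deg w i)%:R = \sum_(j < n) (share (w i) (w j))%:R - 1 :> R.
Proof.
rewrite natr_card (bigD1 i) //= [in RHS](bigD1 i) //= sharexx rkg_adjE eqxx add0r.
rewrite [1 + _]addrC addrK; apply: eq_bigr => j ji.
by rewrite rkg_adjE eq_sym ji.
Qed.

Lemma rkg_deg2E n (i : 'I_n) : let D := \sum_(j < n) (share (w i) (w j))%:R in
  (rkg_deg w i * (rkg_deg w i - 1))%:R = (D - 1) * (D - 2) :> R.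
Proof.
rewrite /= -[_ - 2]/(_ - (1 + 1)) opprD addrA -rkg_degE natrM.
(* Truncated subtraction differs from the real one only at degree 0, where the other factor
   vanishes. *)
by case: (rkg_deg w i) => [|d]; rewrite ?mul0r // subn1 mulrSr addrK.
Qed.

(** Swapping [j] and [k] exchanges the halves [j < k] and [k < j] of the double sum, and the
    diagonal contributes nothing because no vertex is adjacent to itself. *)
Lemma rkg_triE n (i : 'I_n) : 2 * (rkg_tri w i)%:R =
  \sum_(j < n) \sum_(k < n)
    [&& rkg_adj w i j, rkg_adj w i k & rkg_adj w j k]%:R :> R.
Proof.
rewrite natr_card -(pair_bigA _ (fun j k =>
  [&& rkg_adj w i j, rkg_adj w i k, rkg_adj w j k & (j < k)%N]%:R)) /=.
rewrite mulr_natl mulr2n {2}exchange_big -big_split; apply: eq_bigr => j _ /=.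
rewrite -big_split; apply: eq_bigr => k _ /=; rewrite (rkg_adjC k j).
case: ltngtP => [||/val_inj ->]; rewrite ?andbF ?andbT ?addr0 ?add0r //=.
  by rewrite andbCA.
by rewrite rkg_adjxx !andbF.
Qed.

(** Adjacency and [share] differ only on triples with a coincidence among [i], [j], [k]; each of the
    three possible coincidences holds for [n ^ 2] triples. *)
Lemma sum_rkg_tri_close n :
  `|2 * (\sum_(i < n) rkg_tri w i)%:R
    - \sum_(i < n) \sum_(j < n) \sum_(k < n)
      [&& share (w i) (w j), share (w i) (w k) & share (w j) (w k)]%:R|
    <= 3 * n%:R ^+ 2 :> R.
Proof.
have sum_diag (x : 'I_n) : \sum_(y < n) (x == y)%:R = 1 :> R.
  by rewrite (bigD1 x) //= eqxx big1 ?addr0 // => y /negPf; rewrite eq_sym => ->.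
(* Spreading the bound over the triples as coincidence indicators reduces the claim to a termwise
   comparison. *)
have -> : 3 * n%:R ^+ 2 = \sum_(i < n) \sum_(j < n) \sum_(k < n)
    ((i == j)%:R + (i == k)%:R + (j == k)%:R) :> R.
  under eq_bigr do under eq_bigr do
    rewrite !big_split /= !sum_diag sumr_const card_ord.
  under eq_bigr do rewrite !big_split /= !sumr_const sumrMnl sum_diag card_ord.
  by rewrite sumr_const card_ord -mulr_natr; ring.
rewrite natr_sum mulr_sumr -sumrB (le_trans (ler_norm_sum _ _ _)) // ler_sum // => i _.
rewrite rkg_triE -sumrB (le_trans (ler_norm_sum _ _ _)) // ler_sum // => j _.
rewrite -sumrB (le_trans (ler_norm_sum _ _ _)) // ler_sum // => k _.
rewrite !rkg_adjE; case: (i == j) (i == k) (j == k) => [] [] [] /=;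
  case: (share _ _) (share _ _) (share _ _) => [] [] [] /=;
  by rewrite ?subrr ?sub0r ?normrN ?normr0 ?normr1 //=; lra.
Qed.

Let M : R := #|KS K P|%:R.
Hypothesis freq : forall a,
  Un_cv (fun n => (\sum_(i < n) (w i == a)%:R) / n%:R) M^-1.

(** One factor [1 / n] goes to each of [D - 1] and [D - 2], whose constants then vanish in the
    limit; the third serves the mean over [i]. *)
Lemma sum_deg_cv :
  Un_cv (fun n => (\sum_(i < n) rkg_deg w i * (rkg_deg w i - 1))%:R / n%:R ^+ 3)
    ((\sum_a ((\sum_b (share a b)%:R) / M) ^+ 2) / M).
Proof.
pose D n a : R := (\sum_(j < n) (share a (w j))%:R) / n%:R.
have Dcv a : Un_cv (D^~ a) ((\sum_b (share a b)%:R) / M).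
  exact: (mean_cv freq (fun b => Un_cv_cst (share a b)%:R)).
have g_cv a : Un_cv (fun n => (D n a - 1 / n%:R) * (D n a - 2 / n%:R))
    (((\sum_b (share a b)%:R) / M) ^+ 2).
  rewrite expr2 -[X in X * _]subr0 -[X in _ * X]subr0.
  apply: Un_cvM; [apply: Un_cvB (Un_cv_divn 1) | apply: Un_cvB (Un_cv_divn 2)];
    exact: Dcv.
apply: Un_cv_ext (mean_cv freq g_cv) => n /=.
case: n => [|n]; first by rewrite !big_ord0 !mul0r.
rewrite natr_sum !mulr_suml; apply: eq_bigr => i _.
have : n.+1%:R != 0 :> R by rewrite pnatr_eq0.
by rewrite rkg_deg2E /D; move: n.+1%:R => x x0; field.
Qed.

Lemma sum_tri_cv :
  Un_cv (fun n => 2 * (\sum_(i < n) rkg_tri w i)%:R / n%:R ^+ 3)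
    ((\sum_a (\sum_b (\sum_c [&& share a b, share a c & share b c]%:R) / M) / M) / M).
Proof.
pose t a b c : R := [&& share a b, share a c & share b c]%:R.
pose S n := \sum_(i < n) \sum_(j < n) \sum_(k < n) t (w i) (w j) (w k).
have S_cv : Un_cv (fun n => S n / n%:R ^+ 3)
    ((\sum_a (\sum_b (\sum_c t a b c) / M) / M) / M).
  (* The triple sum is resolved from the innermost mean outwards, each limit being the input for the
     next mean. *)
  have cv1 a b : Un_cv (fun n => (\sum_(k < n) t a b (w k)) / n%:R)
      ((\sum_c t a b c) / M).
    exact: (mean_cv freq (fun c => Un_cv_cst (t a b c))).
  have cv2 a : Un_cv (fun n =>
      (\sum_(j < n) (\sum_(k < n) t a (w j) (w k)) / n%:R) / n%:R)
      ((\sum_b (\sum_c t a b c) / M) / M).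
    exact: (mean_cv freq (cv1 a)).
  apply: Un_cv_ext (mean_cv freq cv2) => n.
  rewrite /S !mulr_suml; apply: eq_bigr => i _.
  rewrite !mulr_suml; apply: eq_bigr => j _.
  by rewrite -!mulrA -!invfM !exprS expr0 mulr1.
apply: (@Un_cv_close _ _ (fun n => 3 / n%:R) _ _ _ S_cv) => [n|]; last exact: Un_cv_divn.
case: n => [|n]; first by rewrite /S !big_ord0 mulr0 subrr normr0 invr0 mulr0.
rewrite -mulrBl normrM [X in _ * X]ger0_norm ?invr_ge0 ?exprn_ge0 //.
rewrite ler_pdivrMr ?exprn_gt0 ?ltr0n //.
apply: le_trans (sum_rkg_tri_close _) _; rewrite le_eqVlt; apply/orP; left.
have : n.+1%:R != 0 :> R by rewrite pnatr_eq0.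
by move: n.+1%:R => x x0; apply/eqP; field.
Qed.

End Graph.

(** * Averages over key rings *)

Section Disjoint.
Variables (K P : nat).
Hypotheses (K_gt0 : (0 < K)%N) (leKP : (K <= P)%N).

Lemma card_KS_disjoint (B : {set 'I_P}) :
  #|[set b : KS K P | val b :&: B == set0]| = 'C(P - #|B|, K).
Proof.
rewrite -(card_imset _ val_inj) -[X in (X - _)%N]card_ord -[B in RHS]setCK -cardsCs.
rewrite -cards_draws; apply: eq_card => A; rewrite inE.
apply/imsetP/andP => [[b]|[AB cA]].
  by rewrite inE setI_eq0 disjoints_subset => bB ->; rewrite (valP b).
by exists (Sub A cA); rewrite ?SubK // inE SubK setI_eq0 disjoints_subset.
Qed.

Lemma card_KS : #|KS K P| = 'C(P, K).
Proof.
by rewrite card_sig -[P in RHS]card_ord -card_draws; apply: eq_card => A; rewrite !inE.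
Qed.

Let M : R := #|KS K P|%:R.

Lemma card_KS_neq0 : M != 0.
Proof. by rewrite /M card_KS pnatr_eq0 -lt0n bin_gt0. Qed.

Let dj (a b : KS K P) : R := (val a :&: val b == set0)%:R.

Let djC a b : dj a b = dj b a.
Proof. by rewrite /dj setIC. Qed.

Lemma sum_disjoint (a : KS K P) :
  \sum_(b : KS K P) (val a :&: val b == set0)%:R = M * q_theta K P :> R.
Proof.
under eq_bigr do rewrite setIC; rewrite -natr_card card_KS_disjoint (eqP (valP a)).
rewrite /q_theta !INRE; case: leqP => [_|PK].
  by rewrite RdivE -card_KS mulrC divfK ?card_KS_neq0.
by rewrite mulr0 bin_small //; move: PK K_gt0; lia.
Qed.

Lemma sum_disjoint2 (a b : KS K P) : val a :&: val b == set0 ->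
  \sum_(c : KS K P) ((val a :&: val c == set0) && (val b :&: val c == set0))%:R
  = M * r_theta K P :> R.
Proof.
move=> ab0; have cab : #|val a :|: val b| = (2 * K)%N.
  by rewrite cardsU (eqP ab0) cards0 subn0 (eqP (valP a)) (eqP (valP b)) mul2n addnn.
transitivity (#|[set c : KS K P | val c :&: (val a :|: val b) == set0]|%:R : R).
  rewrite natr_card; apply: eq_bigr => c _.
  by rewrite setIUr setU_eq0 ![_ :&: val c]setIC.
rewrite card_KS_disjoint cab /r_theta !INRE; case: leqP => [_|PK].
  by rewrite RdivE -card_KS mulrC divfK ?card_KS_neq0.
(* Here [r_theta] takes its default value 0; the truncated [P - 2 * K] is below [K] even when it is
   0, as [K] is positive. *)
by rewrite mulr0 bin_small //; move: PK K_gt0; lia.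
Qed.

Let shareE (a b : KS K P) : (share a b)%:R = 1 - dj a b.
Proof. by rewrite /share /dj; case: eqP; rewrite ?subrr ?subr0. Qed.

Lemma mean_share (a : KS K P) : (\sum_b (share a b)%:R) / M = 1 - q_theta K P.
Proof.
under eq_bigr do rewrite shareE; rewrite sumrB sum_disjoint sumr_const -/M.
by field; exact: card_KS_neq0.
Qed.

Lemma mean_deg2 :
  (\sum_a ((\sum_b (@share K P a b)%:R) / M) ^+ 2) / M = (1 - q_theta K P) ^+ 2.
Proof.
under eq_bigr do rewrite mean_share; rewrite sumr_const.
by rewrite -[_ *+ #|_|]mulr_natl -/M; field; exact: card_KS_neq0.
Qed.

(** Expand the product of three factors [1 - dj]. Single terms average to [q], products of two to
    [q ^ 2], and the product of all three to [q * r]; then [1 - 3q + 3q^2 - qr = (1 - q)^3 + q^3 -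
    qr]. *)
Lemma mean_triangle :
  (\sum_a (\sum_b (\sum_c [&& @share K P a b, share a c & share b c]%:R) / M) / M) / M
  = beta_theta K P.
Proof.
set q := q_theta K P; set r := r_theta K P.
have sum1 : \sum_(c : KS K P) 1 = M by rewrite sumr_const.
have sum_c (a b : KS K P) : \sum_c [&& share a b, share a c & share b c]%:R =
    M * (1 - 2 * q) + dj a b * (M * (2 * q - 1 - r)) + \sum_c dj a c * dj b c.
  (* The factor [dj a b] restricts to disjoint [a] and [b], the only case in which [sum_disjoint2]
     evaluates the sum. *)
  have dr : dj a b * (\sum_c dj a c * dj b c) = dj a b * (M * r).
    rewrite {1 4}/dj; case: eqP => [/eqP ab0|_]; rewrite ?mul0r // !mul1r.
    rewrite -(sum_disjoint2 ab0); apply: eq_bigr => c _.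
    by rewrite /dj; case: (_ == _) (_ == _) => [] []; rewrite ?mulr0 ?mulr1.
  transitivity (\sum_c ((1 - dj a b) - (1 - dj a b) * dj a c
      - (1 - dj a b) * dj b c + (1 - dj a b) * (dj a c * dj b c))).
    apply: eq_bigr => c _; rewrite andbA -!mulnb !natrM !shareE; ring.
  rewrite big_split /= !sumrB -!mulr_sumr !sum_disjoint -/q !mulrBl dr.
  rewrite sum1 sumr_const -[_ *+ #|_|]mulr_natl -/M.
  ring.
have sum_bc (a : KS K P) : \sum_b (\sum_c [&& share a b, share a c & share b c]%:R) / M =
    M * (1 - 3 * q + 3 * q ^+ 2 - q * r).
  rewrite -mulr_suml; under eq_bigr do rewrite sum_c.
  (* The sum over [c] of [dj a c * dj b c] depends on how [a] and [b] overlap; summing over [b]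
     first gives [M * q] for every [c]. *)
  rewrite !big_split /= -[X in _ + X + _]mulr_suml sum_disjoint exchange_big /=.
  under [X in _ + X]eq_bigr do
    rewrite -mulr_sumr (eq_bigr _ (fun b _ => djC b _)) sum_disjoint.
  rewrite -[X in _ + X]mulr_suml sum_disjoint sumr_const.
  rewrite -[_ *+ #|_|]mulr_natl -/q -/M.
  by field; exact: card_KS_neq0.
under eq_bigr do rewrite sum_bc.
rewrite sumr_const -[_ *+ #|_|]mulr_natl -/M /beta_theta !RpowE -/q -/r.
rewrite !(RplusE, RminusE, RmultE) R1E.
by field; exact: card_KS_neq0.
Qed.

End Disjoint.

(** * Limit of the clustering coefficient along convergent frequencies *)

Lemma Cstar_cv (K P : nat) (w : sample K P) : (0 < K)%N -> (K <= P)%N ->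
  (forall a, Un_cv (fun n => (\sum_(i < n) (w i == a)%:R) / n%:R) #|KS K P|%:R^-1) ->
  Un_cv (fun n => Cstar w n) (C_K K P).
Proof.
move=> K_gt0 leKP freq; set M : R := #|KS K P|%:R.
have M_gt0 : 0 < M by rewrite lt0r ler0n card_KS_neq0.
(* [1 - q] is the mean of [share (w 0) b] over [b], in which the term [b = w 0] is 1. *)
have q_lt1 : 1 - q_theta K P != 0.
  rewrite -(mean_share K_gt0 leKP (w 0)) mulf_neq0 ?invr_neq0 ?gt_eqF //.
  rewrite (bigD1 (w 0)) //=.
  by rewrite sharexx // ltr_wpDr // sumr_ge0.
have := Un_cvM (sum_tri_cv freq) (Un_cvV _ (sum_deg_cv K_gt0 freq)).
rewrite mean_deg2 // mean_triangle // expf_neq0 // => /(_ isT).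
rewrite /C_K RdivE RpowE; apply: Un_cv_ext => n; rewrite /Cstar !INRE.
case: n => [|n]; first by rewrite !big_ord0 /= mulr0 !mul0r.
have : n.+1%:R != 0 :> R by rewrite pnatr_eq0.
(* Without paths of length 2, the default 0 of [Cstar] agrees with the quotient because
   [0^-1 = 0]. *)
case: ifPn => [D_gt0|]; last by rewrite -eqn0Ngt => /eqP -> _; rewrite mul0r invr0 mulr0.
have : (\sum_(i < n.+1) rkg_deg w i * (rkg_deg w i - 1))%:R != 0 :> R.
  by rewrite pnatr_eq0 -lt0n.
rewrite !RdivE; move: n.+1%:R => x; move: (_%:R) => D D0 x0.
rewrite IZRposE INRE -[nat_of_pos 2]/2%N.
by field; rewrite D0.
Qed.

(** * Concentration of the empirical frequencies *)

Lemma exp_gt0 (x : R) : 0 < exp x.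
Proof. exact/RltP/exp_pos. Qed.

Lemma exp_add (x y : R) : exp (x + y) = exp x * exp y.
Proof. by rewrite expRD. Qed.

Lemma exp_ge1D (x : R) : 1 + x <= exp x.
Proof. exact/RleP/exp_ineq1_le. Qed.

Lemma exp_le (x y : R) : x <= y -> exp x <= exp y.
Proof.
move=> xy; rewrite -[y](subrK x) exp_add ler_peMl ?(ltW (exp_gt0 _)) //.
by apply: le_trans (exp_ge1D _); rewrite lerDl subr_ge0.
Qed.

(** From [1 - x <= exp (- x)] follows [exp x * (1 - x) <= 1], while
    [(1 + x + 2x^2)(1 - x) = 1 + x^2 (1 - 2x)] is at least 1. *)
Lemma exp_le_quad (x : R) : x <= 2^-1 -> exp x <= 1 + x + 2 * x ^+ 2.
Proof.
move=> x_le; have x1 : 0 < 1 - x by lra.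
rewrite -(ler_pM2r x1); apply: (@le_trans _ _ 1).
  have expxN : exp x * exp (- x) = 1 by rewrite -exp_add subrr expR0.
  rewrite -[X in _ <= X]expxN.
  by rewrite ler_wpM2l ?exp_ge1D // ltW ?exp_gt0.
suff : 0 <= x ^+ 2 * (1 - 2 * x) by lra.
by rewrite mulr_ge0 ?sqr_ge0 //; lra.
Qed.

Lemma exp_sum (I : finType) (u : I -> R) :
  exp (\sum_i u i) = \prod_i exp (u i).
Proof.
by apply: (big_morph exp) => [x y|]; [rewrite exp_add | rewrite expR0].
Qed.

Section Hoeffding.
Variables (F : finType) (g : F -> R) (m : nat).
Hypotheses (g_mean0 : \sum_a g a = 0) (g_le1 : forall a, `|g a| <= 1).
Let M : R := #|F|%:R.

Lemma mgf_le (t : R) : 0 <= t <= 2^-1 ->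
  \sum_a exp (t * g a) <= M * exp (2 * t ^+ 2).
Proof.
move=> /andP[t0 t1]; apply: (@le_trans _ _ (\sum_a (1 + 2 * t ^+ 2 + t * g a))).
  apply: ler_sum => a _; apply: le_trans (exp_le_quad _) _.
    by apply: le_trans t1; have := g_le1 a; rewrite ler_norml => /andP[_]; nra.
  have : t ^+ 2 * g a ^+ 2 <= t ^+ 2 * 1.
    by rewrite ler_wpM2l ?sqr_ge0 // -real_normK ?num_real // expr_le1.
  by rewrite exprMn; lra.
rewrite big_split /= -mulr_sumr g_mean0 mulr0 addr0 sumr_const -[_ *+ #|_|]mulr_natl.
by rewrite ler_wpM2l ?ler0n // exp_ge1D.
Qed.

(** Chernoff's method in counting form: the indicator of the event is at most
    [exp (t * (sum - d m))], and the sum of exponentials over all [f] factors into [m] equal sums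
    bounded by [mgf_le]. The bound [d <= 2] keeps [t = d / 4] within the range of [mgf_le]. *)
Lemma hoeffding (d : R) : 0 <= d <= 2 ->
  #|[set f : {ffun 'I_m -> F} | d * m%:R <= \sum_i g (f i)]|%:R
  <= M ^+ m * exp (- (d ^+ 2 * m%:R / 8)).
Proof.
(* d / 4 minimises the exponent 2 t^2 - d t. *)
move=> d02; pose t : R := (d / 4)%R; have t01 : 0 <= t <= 2^-1 by rewrite /t; lra.
rewrite -(ler_pM2r (exp_gt0 (t * (d * m%:R)))) -[M ^+ m * _ * _]mulrA -exp_add.
have -> : - (d ^+ 2 * m%:R / 8) + t * (d * m%:R) = 2 * t ^+ 2 *+ m.
  by rewrite -[_ *+ m]mulr_natr /t; field.
rewrite -expRX -exprMn natr_card mulr_suml.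
apply: (@le_trans _ _ (\sum_(f : {ffun 'I_m -> F}) exp (\sum_i t * g (f i)))).
  apply: ler_sum => f _; case: (boolP (d * m%:R <= _)) => [le_f|_].
    by rewrite mul1r -mulr_sumr exp_le // ler_wpM2l //; case/andP: t01.
  by rewrite mul0r ltW ?exp_gt0.
under eq_bigr do rewrite exp_sum.
rewrite -(bigA_distr_bigA (fun _ a => exp (t * g a))) prodr_const card_ord.
have exp_ge0 x := ltW (exp_gt0 x).
by rewrite lerXn2r ?mgf_le // nnegrE ?mulr_ge0 ?sumr_ge0 ?ler0n.
Qed.

End Hoeffding.

Section Deviation.
Variables (F : finType) (m : nat).
Hypothesis F_gt0 : (0 < #|F|)%N.
Let M : R := #|F|%:R.

Let dev (f : {ffun 'I_m -> F}) (a : F) : R := \sum_i ((f i == a)%:R - M^-1).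

(** Union bound over the values [a] and the two signs of the deviation, which gives the factor
    [2 * M]. *)
Lemma card_deviation (d : R) : 0 <= d <= 2 ->
  #|[set f : {ffun 'I_m -> F} | [exists a,
      d * m%:R <= `|\sum_i ((f i == a)%:R - M^-1)|]]|%:R
  <= 2 * M * (M ^+ m * exp (- (d ^+ 2 * m%:R / 8))).
Proof.
move=> d02; set B := M ^+ m * _; have M_ge1 : 1 <= M by rewrite ler1n.
have M_gt0 : 0 < M by lra.
have sum0 (a : F) : \sum_b ((b == a)%:R - M^-1) = 0.
  rewrite sumrB sumr_const -[_ *+ #|_|]mulr_natl -/M divff ?gt_eqF //.
  by rewrite (bigD1 a) //= eqxx big1 ?addr0 ?subrr // => b /negPf ->.
have le1 (a b : F) : `|(b == a)%:R - M^-1| <= 1.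
  have : 0 < M^-1 <= 1 by rewrite invr_gt0 M_gt0 invf_le1.
  by case: (b == a) => /= /andP[? ?]; rewrite ler_norml; lra.
have up (a : F) : #|[set f | d * m%:R <= dev f a]|%:R <= B.
  exact: (@hoeffding F (fun b => (b == a)%:R - M^-1)).
have down (a : F) : #|[set f | d * m%:R <= - dev f a]|%:R <= B.
  have := @hoeffding F (fun b => - ((b == a)%:R - M^-1)) m _ _ d d02.
  rewrite sumrN sum0 oppr0 => /(_ erefl); under eq_finset do rewrite sumrN.
  by apply => b; rewrite normrN.
apply: (@le_trans _ _ (\sum_(a : F) (B + B))); last first.
  by rewrite sumr_const -[_ *+ #|_|]mulr_natl -/M; lra.
apply: le_trans (ler_sum _ (fun a _ => lerD (up a) (down a))).
rewrite natr_card; under [leRHS]eq_bigr => a _ do rewrite !natr_card -big_split.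
rewrite exchange_big; apply: ler_sum => f _ /=.
case: existsP => [[a]|_]; last by apply: sumr_ge0 => a _; rewrite addr_ge0.
rewrite ler_normr => /orP devs; rewrite (bigD1 a) //= -[X in X <= _]addr0 lerD //.
  by case: devs => ->; rewrite ?lerDl ?lerDr.
by apply: sumr_ge0 => b _; rewrite addr_ge0.
Qed.

End Deviation.

(** * Borel-Cantelli for cylinder events *)

Lemma sum_inv_sqr_le (n J : nat) : (0 < n)%N ->
  \sum_(0 <= k < J) ((n + k).+1%:R ^+ 2)^-1 <= n%:R^-1 - (n + J)%:R^-1 :> R.
Proof.
move=> n_gt0; elim: J => [|J IHJ]; first by rewrite big_nil addn0 subrr.
rewrite big_nat_recr //= addnS.
have : 0 < (n + J)%:R :> R by rewrite ltr0n addn_gt0 n_gt0.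
move: IHJ; rewrite -[(n + J).+1%:R]natr1; move: (\sum_(_ <= _ < _) _) n%:R^-1 => S b.
move: (n + J)%:R => x IH x0.
(* Telescoping: [1 / (x + 1)^2 <= 1 / (x (x + 1)) = 1 / x - 1 / (x + 1)]. *)
have -> : b - (x + 1)^-1 = b - x^-1 + (x * (x + 1))^-1 by field; rewrite !gt_eqF //; lra.
apply: lerD => //; rewrite lef_pV2 ?posrE ?exprn_gt0 ?mulr_gt0 //; nra.
Qed.

Lemma borel_cantelli (K P : nat) (A : forall m, {set {ffun 'I_m -> KS K P}}) (C : R) :
  (forall m, (0 < m)%N -> cyl_prob (A m) <= C / m%:R ^+ 2) ->
  null_set (fun w => forall N, exists2 m, (N < m)%N & in_cyl (A m) w).
Proof.
move=> prob_le eps /RltP eps_gt0.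
have /Un_cvP /(_ _ eps_gt0) [N C_lt] := Un_cv_divn C.
(* The cover starts at index [N + 2], so the telescoped sum is at most [C / (N + 1)], with a nonzero
   denominator even for [N = 0]. *)
exists (fun j => (N.+1 + j).+1), (fun j => A (N.+1 + j).+1); split=> [w inf|J].
  have [m Nm Am] := inf N.+1; exists (m - N.+2)%N.
  by have -> : (N.+1 + (m - N.+2)).+1 = m by lia.
(* The case [m = 1] of [prob_le] bounds a nonnegative probability by [C]. *)
have C_ge0 : 0 <= C.
  have := prob_le 1%N isT; rewrite expr1n divr1; apply: le_trans.
  by rewrite /cyl_prob RdivE !INRE divr_ge0.
apply/RleP; rewrite sum_f_R0E.
apply: (@le_trans _ _ (\sum_(0 <= k < J.+1) (C * ((N.+1 + k).+1%:R ^+ 2)^-1))).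
  by apply: ler_sum => k _; apply: prob_le.
have := C_lt N.+1 (leqnSn N); rewrite subr0 => /ltW; apply: le_trans.
rewrite -mulr_sumr; apply: le_trans (ler_norm _).
rewrite ler_wpM2l //; apply: le_trans (sum_inv_sqr_le _ _) _ => //.
by rewrite gerBl invr_ge0.
Qed.

Lemma null_set_not_freq_cv (K P : nat) : (0 < K)%N -> (K <= P)%N ->
  null_set (fun w : sample K P => ~ forall a,
    Un_cv (fun n => (\sum_(i < n) (w i == a)%:R) / n%:R) #|KS K P|%:R^-1).
Proof.
move=> K_gt0 leKP; set M : R := #|KS K P|%:R.
have M_neq0 : M != 0 by exact: card_KS_neq0.
have card_gt0 : (0 < #|KS K P|)%N by rewrite lt0n -(pnatr_eq0 R).
(* With d m = m^(-1/4) the Hoeffding bound is exp (- sqrt m / 8) = O(m^-2). *)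
pose d (m : nat) : R := Num.sqrt (Num.sqrt m%:R^-1).
pose A m := [set f : {ffun 'I_m -> KS K P} | [exists a,
  d m * m%:R <= `|\sum_i ((f i == a)%:R - M^-1)|]].
have d4 m : d m ^+ 4 = m%:R^-1 by rewrite (exprM _ 2 2) !sqr_sqrtr ?sqrtr_ge0 ?invr_ge0.
have d_ge0 m : 0 <= d m by exact: sqrtr_ge0.
have prob_le m : (0 < m)%N -> cyl_prob (A m) <= 2 * M * 32 ^+ 4 / m%:R ^+ 2.
  move=> m_gt0; have m_ge1 : 1 <= m%:R :> R by rewrite ler1n.
  have d_le1 : d m <= 1.
    by rewrite -(@expr_le1 _ 4) // d4 invf_le1 //; apply: lt_le_trans m_ge1.
  have d02 : 0 <= d m <= 2 by rewrite d_ge0 /=; lra.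
  have Mm_gt0 : 0 < M ^+ m by rewrite exprn_gt0 ?ltr0n.
  rewrite /cyl_prob RdivE pow_INR RpowE !INRE -/M ler_pdivrMr //.
  apply: le_trans (card_deviation _ card_gt0 d02) _; rewrite -/M.
  suff le_e : exp (- (d m ^+ 2 * m%:R / 8)) <= 32 ^+ 4 / m%:R ^+ 2.
    rewrite -[X in _ <= X * _]mulrA -[leRHS]mulrA ler_wpM2l ?mulr_ge0 ?ler0n //.
    by rewrite [leRHS]mulrC ler_wpM2l // ltW.
  (* Here [y] is the square root of [m], and [exp (- y / 8)] is the fourth power of
     [exp (- y / 32) <= 32 / y], whence the constant [32 ^+ 4]. *)
  set y := d m ^+ 2 * m%:R.
  have y4 : y ^+ 4 = m%:R ^+ 2.
    rewrite /y exprMn -exprM (exprM _ 4 2) d4.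
    have : m%:R != 0 :> R by rewrite gt_eqF // (lt_le_trans _ m_ge1).
    by move: m%:R => x x0; field.
  have y_gt0 : 0 < y.
    by rewrite mulr_gt0 ?exprn_gt0 ?sqrtr_gt0 ?invr_gt0 ?ltr0n.
  rewrite -y4 -expr_div_n.
  have -> : - (y / 8) = - (y / 32) *+ 4 by rewrite -[_ *+ 4]mulr_natr; field.
  rewrite -expRX lerXn2r ?nnegrE ?(ltW (exp_gt0 _)) ?divr_ge0 ?(ltW y_gt0) //.
  have e_neq0 : exp (y / 32) != 0 by rewrite gt_eqF ?exp_gt0.
  have -> : exp (- (y / 32)) = (exp (y / 32))^-1.
    by apply: (mulfI e_neq0); rewrite -exp_add subrr expR0 divff.
  rewrite -[32 / y]invf_div lef_pV2 ?posrE ?exp_gt0 ?divr_gt0 //.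
  by apply: le_trans (exp_ge1D _); lra.
move=> eps eps_gt0; have [m [B [B_cover B_sum]]] := borel_cantelli prob_le eps_gt0.
exists m, B; split=> // w not_cv; apply: B_cover => N.
(* If no [A m] with [m > N] occurs, every frequency is eventually within [d m] of [1 / M], and [d m]
   tends to 0. *)
apply: boolp.contrapT => no_m; apply: not_cv => a; apply/Un_cvP => e e_gt0.
(* Since [d n ^+ 4 = 1 / n], the threshold [e ^+ 4] for [1 / n] ensures [d n < e]. *)
have /Un_cvP /(_ (e ^+ 4)) := Un_cv_invn; rewrite exprn_gt0 // => /(_ isT) [N' lt_e].
exists (N + N').+1 => n n_gt.
have n_gt0 : 0 < n%:R :> R by rewrite ltr0n; lia.
have d_lt : d n < e.
  rewrite -(@ltr_pXn2r _ 4) ?nnegrE ?(ltW e_gt0) // d4.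
  by have := lt_e n; rewrite subr0 ger0_norm ?invr_ge0 ?ltW // => -> //; lia.
apply: lt_trans d_lt; rewrite ltNge; apply/negP => le_d.
apply: no_m; exists n; first by lia.
rewrite /in_cyl inE; apply/existsP; exists a.
under eq_bigr do rewrite ffunE.
rewrite sumrB sumr_const card_ord -[M^-1 *+ n]mulr_natr.
have -> : \sum_(i < n) (w i == a)%:R - M^-1 * n%:R =
  ((\sum_(i < n) (w i == a)%:R) / n%:R - M^-1) * n%:R :> R.
  by rewrite mulrBl divfK ?gt_eqF.
by rewrite normrM (ger0_norm (ltW n_gt0)) ler_pM2r.
Qed.

Theorem theorem3 (K P : nat) (hK : (0 < K)%N) (hKP : (K <= P)%N) :
  almost_surely (fun w : sample K P => Un_cv (fun n => Cstar w n) (C_K K P)).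
Proof.
(* Outside the null set of bad frequencies the limit holds, so the same cylinders cover the
   exceptional set. *)
move=> eps eps_gt0; have [m [A [cover sumA]]] := null_set_not_freq_cv hK hKP eps_gt0.
exists m, A; split=> // w not_cv; apply: cover => freq.
by apply: not_cv; apply: Cstar_cv.
Qed.
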